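(* Let $\Bbbk$ be a field and $n\ge 1$. For $s,t\in\Bbbk$ and $M_1,M_2\in M_n(\Bbbk)$ define a binary operation on $M_n(\Bbbk)$ by $$A *_{s,t,M_1,M_2} B = s\,A M_1 B + t\,A M_2 B.$$ Then the semigroup system $(M_n(\Bbbk), *_{s,t,M_1,M_2},\ s,t\in\Bbbk,\ M_1,M_2\in M_n(\Bbbk))$ is a multi-semigroup.
   Context: $M_n(\Bbbk)$ is the set of $n\times n$ matrices over $\Bbbk$. A semigroup system is a set $G$ with a family of binary operations $(G,*_i,i\in I)$ such that $(G,*_i)$ is a semigroup for every $i\in I$. A semigroup system is called a multi-semigroup if $$(a *_i b) *_j c = a *_i (b *_j c)\quad\text{for all } a,b,c\in G,\ i,j\in I.$$ *)

(* Defs.v *)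
From mathcomp Require Import all_boot all_algebra.

Set Implicit Arguments.
Unset Strict Implicit.
Unset Printing Implicit Defensive.

Import GRing.Theory.
Local Open Scope ring_scope.

Definition semigroup_system (G I : Type) (op : I -> G -> G -> G) : Prop :=
  forall i : I, associative (op i).

Definition multi_semigroup (G I : Type) (op : I -> G -> G -> G) : Prop :=
  semigroup_system op /\
  forall (i j : I) (a b c : G), op j (op i a b) c = op i a (op j b c).

Definition mx_op (F : fieldType) (n : nat) (s t : F) (M1 M2 A B : 'M[F]_n) :
    'M[F]_n :=
  s *: (A *m M1 *m B) + t *: (A *m M2 *m B).

(* The family of all these operations, indexed by the quadruples
   (s, t, M1, M2). *)
Definition mx_op_family (F : fieldType) (n : nat)
    (p : F * F * 'M[F]_n * 'M[F]_n) : 'M[F]_n -> 'M[F]_n -> 'M[F]_n :=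
  let: (s, t, M1, M2) := p in mx_op s t M1 M2.

(* Main.v *)
Require Import Defs.
From mathcomp Require Import all_boot all_algebra.

(** The scalars can be moved into the middle factor: each operation is
    [A, B |-> A *m N *m B] for the single matrix [N = s *: M1 + t *: M2].  Both
    bracketings of [A], [B], [C] by two such sandwich products, with middle
    factors [N] and [N'], are then the product [A N B N' C], so the claim is
    associativity of the matrix product. *)

Import GRing.Theory.
Local Open Scope ring_scope.

Lemma mx_op_sandwich (F : fieldType) (n : nat) (s t : F)
    (M1 M2 A B : 'M[F]_n) :
  mx_op s t M1 M2 A B = A *m (s *: M1 + t *: M2) *m B.
Proof. by rewrite /mx_op mulmxDr mulmxDl -!scalemxAr -!scalemxAl. Qed.

Lemma mx_op_interassociative (F : fieldType) (n : nat)
    (p q : F * F * 'M[F]_n * 'M[F]_n) (A B C : 'M[F]_n) :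
  mx_op_family q (mx_op_family p A B) C =
  mx_op_family p A (mx_op_family q B C).
Proof.
case: p => [[[s t] M1] M2]; case: q => [[[s' t'] M1'] M2'].
by rewrite /mx_op_family !mx_op_sandwich !mulmxA.
Qed.

Theorem proposition3p4 (F : fieldType) (n : nat) (n_ge1 : (1 <= n)%N) :
  multi_semigroup (@mx_op_family F n).
Proof.
split=> [p A B C | p q A B C]; last exact: mx_op_interassociative.
(* Each operation is associative because it interassociates with itself. *)
by rewrite mx_op_interassociative.
Qed.
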